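(* All stem covers of a given algebra with bracket $Q$ are mutually isoclinic (as central extensions).
   Context: Fix a ground field $\mathbb{K}$; tensor products are over $\mathbb{K}$. An algebra with bracket (AWB) is an associative (not necessarily commutative, not necessarily unital) $\mathbb{K}$-algebra $A$ with a bilinear map $[-,-]:A\times A\to A$ satisfying $[ab,c]=[a,c]b+a[b,c]$ for all $a,b,c\in A$. Homomorphisms of AWB's are $\mathbb{K}$-linear maps preserving product and bracket. $[[A,A]]$ denotes the two-sided ideal of $A$ spanned by all $ab$ and $[a,b]$, $a,b\in A$. The center is $Z(A)=\{a\in A: ab=ba=0,\ [a,b]=[b,a]=0\ \forall b\in A\}$. A central extension $(G): 0\to N\xrightarrow{\chi}G\xrightarrow{\pi}Q\to 0$ is a short exact sequence of AWB's with $\chi(N)\subseteq Z(G)$. Its commutator maps $C,P:Q\times Q\to[[G,G]]$ are $C(q_1,q_2)=[g_1,g_2]$ and $P(q_1,q_2)=g_1g_2$, where $\pi(g_j)=q_j$. Central extensions $(G_1),(G_2)$ with commutator maps $C_i,P_i$ are isoclinic if there are AWB isomorphisms $\eta:Q_1\to Q_2$, $\xi:[[G_1,G_1]]\to[[G_2,G_2]]$ with $\xi(C_1(q,q'))=C_2(\eta(q),\eta(q'))$ and $\xi(P_1(q,q'))=P_2(\eta(q),\eta(q'))$ for all $q,q'\in Q_1$. Homology: let $d_1:A^{\otimes 2}\oplus A^{\otimes 2}\to A$ and $d_2:A^{\otimes 3}\oplus A^{\otimes 3}\to A^{\otimes 2}\oplus A^{\otimes 2}$ (first summand written with $\otimes$,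 second with $\circ$) be given by $d_1(a\otimes b)=ab$, $d_1(a\circ b)=[a,b]$, $d_2(a\otimes b\otimes c)=ab\otimes c-a\otimes bc$, $d_2(a\circ b\circ c)=[a,c]\otimes b+a\otimes[b,c]-(ab)\circ c$. Then $H_1^{AWB}(A)=\mathrm{Ker}(d_1)/\mathrm{Im}(d_2)$, functorial in $A$. A central extension $(G)$ is a stem cover of $Q$ if $\pi$ induces an isomorphism $G/[[G,G]]\cong Q/[[Q,Q]]$ and the induced map $H_1^{AWB}(G)\to H_1^{AWB}(Q)$ is zero. *)

(* Defs.v *)
From HB Require Import structures.
From mathcomp Require Import all_boot all_order all_algebra.
From mathcomp Require Import boolp freeg.

Set Implicit Arguments.
Unset Strict Implicit.
Unset Printing Implicit Defensive.

Import GRing.Theory.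
Local Open Scope ring_scope.
Local Open Scope quotient_scope.

Section Span.
Context (K : fieldType) (V : lmodType K).

Definition span (P : V -> Prop) : {pred V} := fun x =>
  `[< exists2 s : seq (K * V),
        (forall p, p \in s -> P p.2) & x = \sum_(p <- s) p.1 *: p.2 >].

Lemma span_submod_closed (P : V -> Prop) : submod_closed (span P).
Proof.
split; first by apply/asboolP; exists [::] => //; rewrite big_nil.
move=> c x y /asboolP[s sP ->] /asboolP[t tP ->]; apply/asboolP.
exists ([seq (c * p.1, p.2) | p <- s] ++ t).
  by move=> p; rewrite mem_cat => /orP[/mapP[q qs ->]|]; [exact: (sP q) | exact: tP].
rewrite big_cat big_map scaler_sumr; congr (_ + _).
by apply: eq_bigr => p _; rewrite /= scalerA.
Qed.

HB.instance Definition _ (P : V -> Prop) :=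
  GRing.isSubmodClosed.Build K V (span P)
    (GRing.submod_closed_semi (span_submod_closed P)).

Lemma mem_span (P : V -> Prop) x : P x -> x \in span P.
Proof.
move=> Px; apply/asboolP; exists [:: (1, x)]; last by rewrite big_seq1 scale1r.
by move=> p; rewrite inE => /eqP->.
Qed.

Lemma span_ind (P : V -> Prop) (S : submodClosed V) :
  (forall x, P x -> x \in S) -> {subset span P <= S}.
Proof.
move=> PS x /asboolP[s sP ->]; rewrite big_seq; apply: rpred_sum => p ps.
exact/rpredZ/PS/sP.
Qed.

End Span.

Section Subsp.
Context (K : fieldType) (V : lmodType K) (S : submodClosed V).

Record subsp := Subsp { subsp_val : V; _ : subsp_val \in S }.

HB.instance Definition _ := [isSub for subsp_val].
HB.instance Definition _ := [Choice of subsp by <:].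
HB.instance Definition _ := [SubChoice_isSubLmodule of subsp by <:].

End Subsp.

Section LQuot.
Context (K : fieldType) (V : lmodType K) (S : submodClosed V).

(* Quotient.quot expects a zmodClosed predicate, which submodClosed does not
   inherit from. *)
Definition zmod_of : {pred V} := fun x => x \in S.

Lemma zmod_of_closed : zmod_closed zmod_of.
Proof.
split=> [|x y Sx Sy]; first exact: (rpred0 S).
by rewrite -scaleN1r; apply: (rpredD (S := S)) => //; apply: (rpredZ (s := S)).
Qed.

HB.instance Definition _ := GRing.isZmodClosed.Build V zmod_of zmod_of_closed.

Definition lquot : Type := Quotient.quot zmod_of.

HB.instance Definition _ := GRing.Zmodule.on lquot.
HB.instance Definition _ := Quotient.on lquot.

Definition lpi (x : V) : lquot := \pi_lquot x.

Lemma lpiP x y : lpi x = lpi y <-> x - y \in S.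
Proof. by rewrite (Quotient.idealrBE zmod_of); split=> [/eqP|/eqP]. Qed.

Lemma lpi_repr (x : lquot) : lpi (repr x) = x.
Proof. exact: reprK. Qed.

Lemma repr_lpi x : repr (lpi x) - x \in S.
Proof. by apply/lpiP; rewrite lpi_repr. Qed.

Lemma lpiD x y : lpi (x + y) = lpi x + lpi y.
Proof. exact: (raddfD \pi_(Quotient.quot zmod_of)). Qed.

Definition lquot_scale (c : K) (x : lquot) : lquot := lpi (c *: repr x).

Lemma lpiZ c x : lpi (c *: x) = lquot_scale c (lpi x).
Proof. by apply/lpiP; rewrite -scalerBr rpredZ //; apply/lpiP; rewrite lpi_repr. Qed.

Lemma lquot_scaleA a b x :
  lquot_scale a (lquot_scale b x) = lquot_scale (a * b) x.
Proof. by rewrite -[x]lpi_repr -!lpiZ scalerA. Qed.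

Lemma lquot_scale1 : left_id 1 lquot_scale.
Proof. by move=> x; rewrite -[x]lpi_repr -!lpiZ scale1r. Qed.

Lemma lquot_scaleDr : right_distributive lquot_scale +%R.
Proof.
by move=> c x y; rewrite -[x]lpi_repr -[y]lpi_repr -lpiD -!lpiZ scalerDr lpiD.
Qed.

Lemma lquot_scaleDl x : {morph lquot_scale^~ x : a b / a + b}.
Proof. by move=> a b; rewrite -[x]lpi_repr -!lpiZ scalerDl lpiD. Qed.

HB.instance Definition _ := GRing.Zmodule_isLmodule.Build K lquot
  lquot_scaleA lquot_scale1 lquot_scaleDr lquot_scaleDl.

Lemma lpi_linear : linear lpi.
Proof. by move=> c x y; rewrite lpiD lpiZ. Qed.

HB.instance Definition _ := GRing.isLinear.Build K V lquot _ lpi lpi_linear.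

Lemma lpi_eq0 x : lpi x = 0 <-> x \in S.
Proof. by rewrite -(raddf0 lpi) lpiP subr0. Qed.

(* The factorization of f through the quotient; meaningful if f is linear and
   vanishes on S. *)
Definition lquot_lift (W : lmodType K) (f : V -> W) (x : lquot) : W :=
  f (repr x).

Lemma lquot_liftE (W : lmodType K) (f : {linear V -> W}) :
  (forall x, x \in S -> f x = 0) -> forall x, lquot_lift f (lpi x) = f x.
Proof.
by move=> fS x; apply/eqP; rewrite -subr_eq0 /lquot_lift -linearB fS ?repr_lpi.
Qed.

Lemma lquot_lift_linear (W : lmodType K) (f : {linear V -> W}) :
  (forall x, x \in S -> f x = 0) -> linear (lquot_lift f).
Proof.
move=> fS c x y; rewrite -[x]lpi_repr -[y]lpi_repr -linearP.
by rewrite !lquot_liftE // linearP.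
Qed.

End LQuot.

Section FreegLift.
Context (K : fieldType) (X : choiceType) (W : lmodType K).

HB.instance Definition _ (f : X -> W) :=
  GRing.isZmodMorphism.Build {freeg X / K} W (fglift f) (lift_is_additive f).

Lemma fgliftE (f : X -> W) (D : {freeg X / K}) :
  fglift f D = \sum_(x <- dom D) coeff x D *: f x.
Proof.
rewrite -{1}[D]freeg_sumE raddf_sum.
by apply: eq_bigr => x _; rewrite /= liftU.
Qed.

Lemma fglift_linear (f : X -> W) : linear (fglift f : {freeg X / K} -> W).
Proof.
move=> c D E; rewrite raddfD /=; congr (_ + _).
rewrite [c *: D]/(fgscale c D) /fgscale raddf_sum fgliftE scaler_sumr.
by apply: eq_bigr => x _; rewrite /= liftU scalerA.
Qed.

HB.instance Definition _ (f : X -> W) :=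
  GRing.isLinear.Build K {freeg X / K} W _ (fglift f) (fglift_linear f).

End FreegLift.

Section Tensor.
Context (K : fieldType) (U V : lmodType K).

Definition pure (u : U) (v : V) : {freeg (U * V)%type / K} :=
  Freeg [:: (1, (u, v))].

Inductive tensor_rel : {freeg (U * V)%type / K} -> Prop :=
| TensorDl u u' v : tensor_rel (pure (u + u') v - (pure u v + pure u' v))
| TensorDr u v v' : tensor_rel (pure u (v + v') - (pure u v + pure u v'))
| TensorZl c u v : tensor_rel (pure (c *: u) v - c *: pure u v)
| TensorZr c u v : tensor_rel (pure u (c *: v) - c *: pure u v).

Definition tensor := lquot (span tensor_rel).

HB.instance Definition _ := GRing.Lmodule.on tensor.

Definition tens (u : U) (v : V) : tensor := lpi (span tensor_rel) (pure u v).

Lemma tens_bilinear : bilinear_for *:%R *:%R tens.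
Proof.
have aux (M : zmodType) (x y z w : M) :
  x - (z + w) = (x - (y + w)) + (y - z).
  by rewrite !opprD !addrA [x - y - w + y]addrAC subrK addrAC.
split=> [v c u u'|u c v v'] /=; rewrite /tens -linearP; apply/lpiP.
  rewrite (aux _ _ (pure (c *: u) v)).
  exact: rpredD (mem_span (TensorDl _ _ _)) (mem_span (TensorZl _ _ _)).
rewrite (aux _ _ (pure u (c *: v))).
exact: rpredD (mem_span (TensorDr _ _ _)) (mem_span (TensorZr _ _ _)).
Qed.

(* The linear map u (x) v |-> f u v; meaningful if f is bilinear. *)
Definition tensor_lift (W : lmodType K) (f : U -> V -> W) : tensor -> W :=
  lquot_lift (fglift (fun p : U * V => f p.1 p.2)).

Section TensorLift.
Context (W : lmodType K) (f : U -> V -> W).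
Hypothesis f_bilinear : bilinear_for *:%R *:%R f.

Let fl : {freeg (U * V)%type / K} -> W := fglift (fun p : U * V => f p.1 p.2).

Lemma fglift_tensor_rel x : x \in span tensor_rel -> fl x = 0.
Proof.
have flp u v : fl (pure u v) = f u v.
  by rewrite /fl /pure liftU scale1r.
have fL c u u' v : f (c *: u + u') v = c *: f u v + f u' v.
  exact: f_bilinear.1 v c u u'.
have fR u c v v' : f u (c *: v + v') = c *: f u v + f u v'.
  exact: f_bilinear.2 u c v v'.
have fDl u u' v : f (u + u') v = f u v + f u' v.
  by have := fL 1 u u' v; rewrite !scale1r.
have fDr u v v' : f u (v + v') = f u v + f u v'.
  by have := fR u 1 v v'; rewrite !scale1r.
have f0l v : f 0 v = 0.
  by apply: (addIr (f 0 v)); rewrite -fDl !add0r.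
have f0r u : f u 0 = 0.
  by apply: (addIr (f u 0)); rewrite -fDr !add0r.
have fZl c u v : f (c *: u) v = c *: f u v.
  by have := fL c u 0 v; rewrite f0l !addr0.
have fZr c u v : f u (c *: v) = c *: f u v.
  by have := fR u c v 0; rewrite f0r !addr0.
move=> /asboolP[s sP ->]; rewrite big_seq /fl linear_sum big1 // => p /sP.
rewrite linearZ /= -/fl => p_rel; suff -> : fl p.2 = 0 by rewrite scaler0.
case: p_rel => [u u' v|u v v'|c u v|c u v].
- by rewrite /fl linearB linearD /= -/fl !flp fDl subrr.
- by rewrite /fl linearB linearD /= -/fl !flp fDr subrr.
- by rewrite /fl linearB linearZ /= -/fl !flp fZl subrr.
- by rewrite /fl linearB linearZ /= -/fl !flp fZr subrr.
Qed.

Lemma tensor_liftE u v : tensor_lift f (tens u v) = f u v.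
Proof.
rewrite /tensor_lift /tens lquot_liftE; last exact: fglift_tensor_rel.
by rewrite /pure /= liftU scale1r.
Qed.

Lemma tensor_lift_linear : linear (tensor_lift f).
Proof. exact/lquot_lift_linear/fglift_tensor_rel. Qed.

End TensorLift.

Lemma tensPl c u u' v : tens (c *: u + u') v = c *: tens u v + tens u' v.
Proof. exact: tens_bilinear.1 v c u u'. Qed.

Lemma tensPr c u v v' : tens u (c *: v + v') = c *: tens u v + tens u v'.
Proof. exact: tens_bilinear.2 u c v v'. Qed.

Lemma tensor_sum (t : tensor) :
  exists s : seq (K * (U * V)), t = \sum_(p <- s) p.1 *: tens p.2.1 p.2.2.
Proof.
exists [seq (coeff p (repr t), p) | p <- dom (repr t)].
rewrite big_map -[LHS]lpi_repr -{1}[repr t]freeg_sumE linear_sum.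
apply: eq_bigr => -[u v] _ /=; rewrite /tens -linearZ /=; congr lpi.
by apply/eqP/freeg_eqP => p; rewrite coeffZ !coeffU mul1r.
Qed.

Lemma tensor_ext (W : lmodType K) (f g : tensor -> W) :
  linear f -> linear g -> (forall u v, f (tens u v) = g (tens u v)) -> f =1 g.
Proof.
move=> f_lin g_lin fg t; have [s ->] := tensor_sum t.
have lin0 (h : tensor -> W) : linear h -> h 0 = 0.
  move=> h_lin; have := h_lin (-1) 0 0.
  by rewrite scaler0 addr0 scaleN1r addNr.
elim: s => [|p s IHs]; first by rewrite big_nil !lin0.
by rewrite big_cons f_lin g_lin IHs fg.
Qed.

End Tensor.


Section TensorMaps.
Context (K : fieldType).

Definition tensor_map (U V U' V' : lmodType K) (f : U -> U') (g : V -> V') :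
    tensor U V -> tensor U' V' :=
  tensor_lift (fun u v => tens (f u) (g v)).

Section Linear.
Context (U V U' V' : lmodType K) (f : {linear U -> U'}) (g : {linear V -> V'}).

Lemma tensor_map_bilinear :
  bilinear_for *:%R *:%R (fun u v => tens (f u) (g v)).
Proof.
by split=> [v c u u'|u c v v'] /=; rewrite linearP (tensPl, tensPr).
Qed.

Lemma tensor_mapE u v : tensor_map f g (tens u v) = tens (f u) (g v).
Proof. exact: tensor_liftE tensor_map_bilinear u v. Qed.

Lemma tensor_map_linear : linear (tensor_map f g).
Proof. exact: tensor_lift_linear tensor_map_bilinear. Qed.

HB.instance Definition _ := GRing.isLinear.Build K (tensor U V) (tensor U' V') _
  (tensor_map f g) tensor_map_linear.

Lemma tensor_map0 : tensor_map f g 0 = 0.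
Proof. exact: raddf0. Qed.

Lemma tensor_mapD : {morph tensor_map f g : s t / s + t}.
Proof. exact: raddfD. Qed.

Lemma tensor_mapN : {morph tensor_map f g : t / - t}.
Proof. exact: raddfN. Qed.

Lemma tensor_mapB : {morph tensor_map f g : s t / s - t}.
Proof. exact: raddfB. Qed.

End Linear.

Section Trilinear.
Context (U V X W : lmodType K) (f : U -> V -> X -> W).

Definition trilinear :=
  (forall v x, linear (fun u => f u v x)) /\
  (forall u, bilinear_for *:%R *:%R (f u)).

(* The linear map u (x) (v (x) x) |-> f u v x; meaningful if f is trilinear. *)
Definition tensor_lift3 : tensor U (tensor V X) -> W :=
  tensor_lift (fun u t => tensor_lift (f u) t).

Hypothesis f_trilinear : trilinear.

Lemma tensor_lift3_bilinear :
  bilinear_for *:%R *:%R (fun u t => tensor_lift (f u) t).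
Proof.
split=> [t c u u'|u] /=; last exact: tensor_lift_linear (f_trilinear.2 u).
rewrite /tensor_lift /lquot_lift !fgliftE scaler_sumr -big_split.
apply: eq_bigr => p _ /=.
by rewrite (f_trilinear.1 p.1 p.2 c u u') scalerDr !scalerA mulrC.
Qed.

Lemma tensor_lift3E u v x : tensor_lift3 (tens u (tens v x)) = f u v x.
Proof.
rewrite /tensor_lift3 (tensor_liftE tensor_lift3_bilinear).
exact: tensor_liftE (f_trilinear.2 u) v x.
Qed.

Lemma tensor_lift3_linear : linear tensor_lift3.
Proof. exact: tensor_lift_linear tensor_lift3_bilinear. Qed.

End Trilinear.

Lemma tensor3_ext (U V X W : lmodType K) (f g : tensor U (tensor V X) -> W) :
  linear f -> linear g ->
  (forall u v x, f (tens u (tens v x)) = g (tens u (tens v x))) -> f =1 g.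
Proof.
move=> f_lin g_lin fg; apply: tensor_ext => // u.
have comp_lin (h : tensor U (tensor V X) -> W) :
    linear h -> linear (fun t => h (tens u t)).
  by move=> h_lin c s t; rewrite tensPr h_lin.
exact: tensor_ext (comp_lin _ f_lin) (comp_lin _ g_lin) (fg u).
Qed.

End TensorMaps.

HB.mixin Record Lmodule_isAWB (K : fieldType) A of GRing.Lmodule K A := {
  awb_mul : A -> A -> A;
  awb_br : A -> A -> A;
  awb_mul_bilinear : bilinear_for *:%R *:%R awb_mul;
  awb_br_bilinear : bilinear_for *:%R *:%R awb_br;
  awb_mulA : associative awb_mul;
  awb_leibniz : forall a b c,
    awb_br (awb_mul a b) c = awb_mul (awb_br a c) b + awb_mul a (awb_br b c)
}.

#[short(type="awbType")]
HB.structure Definition AWB (K : fieldType) :=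
  {A of GRing.Lmodule K A & Lmodule_isAWB K A}.

Declare Scope awb_scope.
Delimit Scope awb_scope with awb.
Local Open Scope awb_scope.
Notation "a ** b" := (awb_mul a b) (at level 40, left associativity) : awb_scope.
Notation "[br a , b ]" := (awb_br a b) (at level 0, a at level 99, b at level 99,
  format "[br  a ,  b ]") : awb_scope.

HB.mixin Record isAWBHom (K : fieldType) (A B : awbType K) (f : A -> B) := {
  awb_homM : forall a b, f (a ** b) = f a ** f b;
  awb_homB : forall a b, f [br a, b] = [br f a, f b]
}.

HB.structure Definition AWBHom (K : fieldType) (A B : awbType K) :=
  {f of @GRing.Linear K A B *:%R f & isAWBHom K A B f}.

Notation "{ 'awbhom' A -> B }" := (AWBHom.type A B)
  (at level 0, A at level 98, B at level 99, format "{ 'awbhom'  A  ->  B }").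

Section AWBTheory.
Context (K : fieldType) (A : awbType K).
Implicit Types (a b c : A) (k : K).

Lemma awb_mulPl k a a' b : (k *: a + a') ** b = k *: (a ** b) + a' ** b.
Proof. exact: awb_mul_bilinear.1 b k a a'. Qed.

Lemma awb_mulPr k a b b' : a ** (k *: b + b') = k *: (a ** b) + a ** b'.
Proof. exact: awb_mul_bilinear.2 a k b b'. Qed.

Lemma awb_brPl k a a' b : [br k *: a + a', b] = k *: [br a, b] + [br a', b].
Proof. exact: awb_br_bilinear.1 b k a a'. Qed.

Lemma awb_brPr k a b b' : [br a, k *: b + b'] = k *: [br a, b] + [br a, b'].
Proof. exact: awb_br_bilinear.2 a k b b'. Qed.

Definition in_center a : Prop := forall b,
  [/\ a ** b = 0, b ** a = 0, [br a, b] = 0 & [br b, a] = 0].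

Inductive derived_gen : A -> Prop :=
| DerivedMul a b : derived_gen (a ** b)
| DerivedBr a b : derived_gen [br a, b].

Definition in_derived : {pred A} := span derived_gen.

HB.instance Definition _ := GRing.SubmodClosed.on in_derived.

Lemma derived_mul a b : a ** b \in in_derived.
Proof. exact/mem_span/DerivedMul. Qed.

Lemma derived_br a b : [br a, b] \in in_derived.
Proof. exact/mem_span/DerivedBr. Qed.

(* The linear span in_derived is a two-sided ideal. *)
Lemma derived_ideal a x : x \in in_derived ->
  [/\ a ** x \in in_derived, x ** a \in in_derived,
      [br a, x] \in in_derived & [br x, a] \in in_derived].
Proof. by split; rewrite ?derived_mul ?derived_br. Qed.

End AWBTheory.

Section Derived.
Context (K : fieldType) (A : awbType K).

Definition derived : Type := subsp (@in_derived K A).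

HB.instance Definition _ := GRing.Lmodule.on derived.
HB.instance Definition _ := SubType.on derived.

Implicit Types x y z : derived.

Definition to_derived (a : A) (a_in : a \in @in_derived K A) : derived :=
  Subsp a_in.

Definition derived_mulop x y : derived :=
  to_derived (derived_mul (val x) (val y)).
Definition derived_brop x y : derived :=
  to_derived (derived_br (val x) (val y)).

Lemma derived_mulop_bilinear : bilinear_for *:%R *:%R derived_mulop.
Proof.
by split=> [y k x x'|x k y y'] /=; apply: val_inj;
  rewrite /= (awb_mulPl, awb_mulPr).
Qed.

Lemma derived_brop_bilinear : bilinear_for *:%R *:%R derived_brop.
Proof.
by split=> [y k x x'|x k y y'] /=; apply: val_inj;
  rewrite /= (awb_brPl, awb_brPr).
Qed.

Lemma derived_mulopA : associative derived_mulop.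
Proof. by move=> x y z; apply: val_inj; rewrite /= awb_mulA. Qed.

Lemma derived_leibniz x y z :
  derived_brop (derived_mulop x y) z =
  derived_mulop (derived_brop x z) y + derived_mulop x (derived_brop y z).
Proof. by apply: val_inj; rewrite /= awb_leibniz. Qed.

HB.instance Definition _ := Lmodule_isAWB.Build K derived
  derived_mulop_bilinear derived_brop_bilinear derived_mulopA derived_leibniz.

End Derived.

(* A / [[A, A]] with the induced product and bracket (which vanish). *)
Section Abelianization.
Context (K : fieldType) (A : awbType K).

Definition ab : Type := lquot (@in_derived K A).

HB.instance Definition _ := GRing.Lmodule.on ab.

Definition to_ab (a : A) : ab := lpi (@in_derived K A) a.

Definition ab_mulop (x y : ab) : ab := to_ab (repr x ** repr y).
Definition ab_brop (x y : ab) : ab := to_ab [br repr x, repr y].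

Lemma ab_mulop0 x y : ab_mulop x y = 0.
Proof. by apply/lpi_eq0; apply: derived_mul. Qed.

Lemma ab_brop0 x y : ab_brop x y = 0.
Proof. by apply/lpi_eq0; apply: derived_br. Qed.

Lemma ab_mulop_bilinear : bilinear_for *:%R *:%R ab_mulop.
Proof. by split=> [y k x x'|x k y y'] /=; rewrite !ab_mulop0 scaler0 addr0. Qed.

Lemma ab_brop_bilinear : bilinear_for *:%R *:%R ab_brop.
Proof. by split=> [y k x x'|x k y y'] /=; rewrite !ab_brop0 scaler0 addr0. Qed.

Lemma ab_mulopA : associative ab_mulop.
Proof. by move=> x y z; rewrite !ab_mulop0. Qed.

Lemma ab_leibniz x y z :
  ab_brop (ab_mulop x y) z = ab_mulop (ab_brop x z) y + ab_mulop x (ab_brop y z).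
Proof. by rewrite !ab_mulop0 ab_brop0 addr0. Qed.

HB.instance Definition _ := Lmodule_isAWB.Build K ab
  ab_mulop_bilinear ab_brop_bilinear ab_mulopA ab_leibniz.

Lemma to_ab_linear : linear to_ab.
Proof. exact: linearP. Qed.

Lemma to_abM a b : to_ab (a ** b) = to_ab a ** to_ab b.
Proof.
by rewrite [RHS]ab_mulop0; apply/lpi_eq0; apply: derived_mul.
Qed.

Lemma to_abB a b : to_ab [br a, b] = [br to_ab a, to_ab b].
Proof.
by rewrite [RHS]ab_brop0; apply/lpi_eq0; apply: derived_br.
Qed.

HB.instance Definition _ := GRing.isLinear.Build K A ab _ to_ab to_ab_linear.
HB.instance Definition _ := isAWBHom.Build K A ab to_ab to_abM to_abB.

End Abelianization.

Section AbMap.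
Context (K : fieldType) (A B : awbType K) (f : {awbhom A -> B}).

Definition ab_map : ab A -> ab B := lquot_lift (fun a => to_ab (f a)).

Lemma to_ab_hom_derived a : a \in @in_derived K A -> to_ab (f a) = 0.
Proof.
move=> /asboolP[s sP ->]; rewrite !linear_sum big_seq big1 // => p /sP.
rewrite !linearZ /= => p_gen; suff -> : to_ab (f p.2) = 0 by rewrite scaler0.
by apply/lpi_eq0; case: p_gen => a1 a2;
  rewrite ?awb_homM ?awb_homB ?derived_mul ?derived_br.
Qed.

Lemma ab_mapE a : ab_map (to_ab a) = to_ab (f a).
Proof.
exact: (@lquot_liftE K A _ (ab B) (@to_ab K B \o f) to_ab_hom_derived).
Qed.

Lemma ab_map_linear : linear ab_map.
Proof.
exact: (@lquot_lift_linear K A _ (ab B) (@to_ab K B \o f) to_ab_hom_derived).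
Qed.

Lemma ab_mapM x y : ab_map (x ** y) = ab_map x ** ab_map y.
Proof.
by rewrite -[x]lpi_repr -[y]lpi_repr -to_abM !ab_mapE awb_homM to_abM.
Qed.

Lemma ab_mapB x y : ab_map [br x, y] = [br ab_map x, ab_map y].
Proof.
by rewrite -[x]lpi_repr -[y]lpi_repr -to_abB !ab_mapE awb_homB to_abB.
Qed.

HB.instance Definition _ :=
  GRing.isLinear.Build K (ab A) (ab B) _ ab_map ab_map_linear.
HB.instance Definition _ := isAWBHom.Build K (ab A) (ab B) ab_map ab_mapM ab_mapB.

End AbMap.

Section Complex.
Context (K : fieldType) (A : awbType K).

(* In both C1 and C2 the first component is the summand written with (x), the
   second the one written with o. *)
Definition C1 : Type := (tensor A A * tensor A A)%type.
Definition C2 : Type :=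
  (tensor A (tensor A A) * tensor A (tensor A A))%type.

HB.instance Definition _ := GRing.Lmodule.on C1.
HB.instance Definition _ := GRing.Lmodule.on C2.

Definition d1 (x : C1) : A :=
  tensor_lift (@awb_mul K A) x.1 + tensor_lift (@awb_br K A) x.2.

Definition d2_tens (a b c : A) : C1 := (tens (a ** b) c - tens a (b ** c), 0).

Definition d2_circ (a b c : A) : C1 :=
  (tens [br a, c] b + tens a [br b, c], - tens (a ** b) c).

Definition d2 (y : C2) : C1 :=
  tensor_lift3 d2_tens y.1 + tensor_lift3 d2_circ y.2.

Lemma d1_linear : linear d1.
Proof.
move=> k x y; rewrite /d1 /=.
rewrite (tensor_lift_linear (awb_mul_bilinear (s := A))).
rewrite (tensor_lift_linear (awb_br_bilinear (s := A))).
by rewrite scalerDr addrACA.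
Qed.

HB.instance Definition _ := GRing.isLinear.Build K C1 A _ d1 d1_linear.

Lemma d2_tens_trilinear : trilinear d2_tens.
Proof.
split=> [b c k a a'|a]; last split=> [c k b b'|b k c c'];
  apply: injective_projections; rewrite /= ?scaler0 ?addr0 //.
- by rewrite awb_mulPl !tensPl scalerBr opprD addrACA.
- by rewrite awb_mulPl awb_mulPr tensPl !tensPr scalerBr opprD addrACA.
- by rewrite awb_mulPr !tensPr scalerBr opprD addrACA.
Qed.

Lemma d2_circ_trilinear : trilinear d2_circ.
Proof.
split=> [b c k a a'|a]; last split=> [c k b b'|b k c c'];
  apply: injective_projections; rewrite /= ?scalerN -?opprD.
- by rewrite awb_brPl !tensPl scalerDr addrACA.
- by rewrite awb_mulPl tensPl.
- by rewrite awb_brPl !tensPr scalerDr addrACA.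
- by rewrite awb_mulPr tensPl.
- by rewrite !awb_brPr tensPl tensPr scalerDr addrACA.
- by rewrite tensPr.
Qed.

Lemma d2_linear : linear d2.
Proof.
move=> k x y; rewrite /d2 /=.
rewrite (tensor_lift3_linear d2_tens_trilinear).
rewrite (tensor_lift3_linear d2_circ_trilinear).
by rewrite scalerDr addrACA.
Qed.

HB.instance Definition _ := GRing.isLinear.Build K C2 C1 _ d2 d2_linear.

Lemma d1_tens a b : d1 (tens a b, 0) = a ** b.
Proof.
rewrite /d1 /= (tensor_liftE (awb_mul_bilinear (s := A))).
have f_lin := tensor_lift_linear (awb_br_bilinear (s := A)).
have := f_lin (-1) 0 0; rewrite scaler0 addr0 scaleN1r addNr => ->.
by rewrite addr0.
Qed.

Lemma d1_circ a b : d1 (0, tens a b) = [br a, b].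
Proof.
rewrite /d1 /= (tensor_liftE (awb_br_bilinear (s := A))).
have f_lin := tensor_lift_linear (awb_mul_bilinear (s := A)).
have := f_lin (-1) 0 0; rewrite scaler0 addr0 scaleN1r addNr => ->.
by rewrite add0r.
Qed.

Lemma C2_ext (W : lmodType K) (f g : {linear C2 -> W}) :
  (forall a b c, f (tens a (tens b c), 0) = g (tens a (tens b c), 0)) ->
  (forall a b c, f (0, tens a (tens b c)) = g (0, tens a (tens b c))) ->
  f =1 g.
Proof.
move=> fg1 fg2 -[x y].
have lin1 (h : {linear C2 -> W}) : linear (fun t => h (t, 0)).
  move=> k s t; rewrite -linearP; congr (h _).
  by apply: injective_projections; rewrite //= scaler0 addr0.
have lin2 (h : {linear C2 -> W}) : linear (fun t => h (0, t)).
  move=> k s t; rewrite -linearP; congr (h _).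
  by apply: injective_projections; rewrite //= scaler0 addr0.
have -> : (x, y) = (x, 0) + (0, y) :> C2.
  by apply: injective_projections; rewrite /= ?addr0 ?add0r.
rewrite !linearD; congr (_ + _).
- exact: (tensor3_ext (lin1 f) (lin1 g)).
- exact: (tensor3_ext (lin2 f) (lin2 g)).
Qed.

Lemma d2_tensE a b c : d2 (tens a (tens b c), 0) = d2_tens a b c.
Proof.
rewrite /d2 /= (tensor_lift3E d2_tens_trilinear).
have f_lin := tensor_lift3_linear d2_circ_trilinear.
have := f_lin (-1) 0 0; rewrite scaler0 addr0 scaleN1r addNr => ->.
by rewrite addr0.
Qed.

Lemma d2_circE a b c : d2 (0, tens a (tens b c)) = d2_circ a b c.
Proof.
rewrite /d2 /= (tensor_lift3E d2_circ_trilinear).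
have f_lin := tensor_lift3_linear d2_tens_trilinear.
have := f_lin (-1) 0 0; rewrite scaler0 addr0 scaleN1r addNr => ->.
by rewrite add0r.
Qed.

Lemma C1_split (x y : tensor A A) : (x, y) = (x, 0) + (0, y) :> C1.
Proof. by apply: injective_projections; rewrite /= ?addr0 ?add0r. Qed.

Lemma d1_d2 y : d1 (d2 y) = 0.
Proof.
apply: (C2_ext (f := (d1 \o d2 : {linear C2 -> A})) (g := \0)) => a b c /=.
- rewrite d2_tensE.
  have -> : d2_tens a b c = (tens (a ** b) c, 0) - (tens a (b ** c), 0) :> C1.
    by apply: injective_projections; rewrite /= ?subr0.
  by rewrite linearB /= !d1_tens awb_mulA subrr.
- rewrite d2_circE.
  have -> : d2_circ a b c = (tens [br a, c] b, 0) + (tens a [br b, c], 0)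
      - (0, tens (a ** b) c) :> C1.
    by apply: injective_projections; rewrite /= ?subr0 ?addr0 ?sub0r.
  by rewrite linearB linearD /= !d1_tens d1_circ awb_leibniz subrr.
Qed.

Definition kernel1 : {pred C1} := fun x => d1 x == 0.

Lemma kernel1_closed : submod_closed kernel1.
Proof.
split; first by rewrite unfold_in /= linear0.
move=> k x y; rewrite !unfold_in => /eqP dx0 /eqP dy0.
by rewrite linearP /= dx0 dy0 scaler0 addr0.
Qed.

HB.instance Definition _ := GRing.isSubmodClosed.Build K C1 kernel1
  (GRing.submod_closed_semi kernel1_closed).

Definition Z1 : Type := subsp kernel1.

HB.instance Definition _ := GRing.Lmodule.on Z1.
HB.instance Definition _ := SubType.on Z1.

Definition image2 : {pred Z1} := fun z => `[< exists y : C2, d2 y = val z >].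

Lemma image2_closed : submod_closed image2.
Proof.
split; first by apply/asboolP; exists 0; rewrite linear0.
move=> k z z' /asboolP[y yz] /asboolP[y' yz']; apply/asboolP.
by exists (k *: y + y'); rewrite linearP /= yz yz'.
Qed.

HB.instance Definition _ := GRing.isSubmodClosed.Build K Z1 image2
  (GRing.submod_closed_semi image2_closed).

Definition H1 : Type := lquot image2.

HB.instance Definition _ := GRing.Lmodule.on H1.

End Complex.

Section H1Map.
Context (K : fieldType) (A B : awbType K) (f : {awbhom A -> B}).

Definition C1_map (x : C1 A) : C1 B := (tensor_map f f x.1, tensor_map f f x.2).

Definition C2_map (y : C2 A) : C2 B :=
  (tensor_map f (tensor_map f f) y.1, tensor_map f (tensor_map f f) y.2).

Lemma C1_map_linear : linear C1_map.
Proof.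
by move=> k x y; apply: injective_projections; apply: tensor_map_linear.
Qed.

Lemma C2_map_linear : linear C2_map.
Proof.
by move=> k x y; apply: injective_projections; apply: tensor_map_linear.
Qed.

HB.instance Definition _ :=
  GRing.isLinear.Build K (C1 A) (C1 B) _ C1_map C1_map_linear.
HB.instance Definition _ :=
  GRing.isLinear.Build K (C2 A) (C2 B) _ C2_map C2_map_linear.

Lemma d1_map x : d1 (C1_map x) = f (d1 x).
Proof.
have lift_map (op : forall C : awbType K, C -> C -> C) :
    (forall C, bilinear_for *:%R *:%R (@op C)) ->
    (forall a b, f (op A a b) = op B (f a) (f b)) ->
    forall t, tensor_lift (@op B) (tensor_map f f t) = f (tensor_lift (@op A) t).
  move=> op_bil op_hom; apply: tensor_ext.
  - move=> k s t; apply: etrans (tensor_lift_linear (op_bil B) k _ _).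
    exact/congr1/tensor_map_linear.
  - by move=> k s t; rewrite (tensor_lift_linear (op_bil A)) linearP.
  - by move=> a b; rewrite tensor_mapE !tensor_liftE ?op_hom.
rewrite /d1 linearD; congr (_ + _).
- by apply: (lift_map (fun C => @awb_mul K C)) => [C|a b];
    [exact: awb_mul_bilinear | exact: awb_homM].
- by apply: (lift_map (fun C => @awb_br K C)) => [C|a b];
    [exact: awb_br_bilinear | exact: awb_homB].
Qed.

Lemma tensor_map3E a b c :
  tensor_map f (tensor_map f f) (tens a (tens b c)) =
  tens (f a) (tens (f b) (f c)).
Proof.
exact: etrans (tensor_mapE f _ a (tens b c))
              (congr1 (tens (f a)) (tensor_mapE f f b c)).
Qed.

Lemma tensor_map_mul a b c :
  tensor_map f f (tens (a ** b) c) = tens (f a ** f b) (f c).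
Proof.
exact: etrans (tensor_mapE f f (a ** b) c)
              (congr1 (fun x => tens x (f c)) (awb_homM a b)).
Qed.

Lemma C1_map_tens a b c : C1_map (d2_tens a b c) = d2_tens (f a) (f b) (f c).
Proof.
rewrite /C1_map /d2_tens [fst _]/= [snd _]/=; congr pair.
  rewrite tensor_mapB tensor_map_mul (tensor_mapE f f a).
  congr (_ - tens _ _); exact: awb_homM.
exact: tensor_map0.
Qed.

Lemma C1_map_circ a b c : C1_map (d2_circ a b c) = d2_circ (f a) (f b) (f c).
Proof.
rewrite /C1_map /d2_circ [fst _]/= [snd _]/=; congr pair.
  rewrite tensor_mapD (tensor_mapE f f a) (tensor_mapE f f [br a, c]).
  congr (tens _ _ + tens _ _); exact: awb_homB.
by rewrite tensor_mapN tensor_map_mul.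
Qed.

Lemma C2_map_tens a b c : C2_map (tens a (tens b c), 0) =
  (tens (f a) (tens (f b) (f c)), 0).
Proof. by congr pair; [exact: tensor_map3E | exact: tensor_map0]. Qed.

Lemma C2_map_circ a b c : C2_map (0, tens a (tens b c)) =
  (0, tens (f a) (tens (f b) (f c))).
Proof. by congr pair; [exact: tensor_map0 | exact: tensor_map3E]. Qed.

Lemma d2_map y : d2 (C2_map y) = C1_map (d2 y).
Proof.
apply: (C2_ext (f := (@d2 K B \o C2_map : {linear C2 A -> C1 B}))
               (g := (C1_map \o @d2 K A : {linear C2 A -> C1 B}))) => a b c.
- apply: etrans (congr1 (@d2 K B) (C2_map_tens a b c)) _.
  apply: etrans (d2_tensE (f a) (f b) (f c)) _.
  exact: esym (etrans (congr1 C1_map (d2_tensE a b c)) (C1_map_tens a b c)).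
- apply: etrans (congr1 (@d2 K B) (C2_map_circ a b c)) _.
  apply: etrans (d2_circE (f a) (f b) (f c)) _.
  exact: esym (etrans (congr1 C1_map (d2_circE a b c)) (C1_map_circ a b c)).
Qed.

Lemma Z1_map_subproof (z : Z1 A) : C1_map (val z) \in @kernel1 K B.
Proof.
by case: z => x /= /eqP dx0; rewrite unfold_in d1_map dx0 linear0.
Qed.

Definition Z1_map (z : Z1 A) : Z1 B := Subsp (Z1_map_subproof z).

Lemma Z1_map_linear : linear Z1_map.
Proof. by move=> k z z'; apply: val_inj; rewrite /= linearP. Qed.

HB.instance Definition _ :=
  GRing.isLinear.Build K (Z1 A) (Z1 B) _ Z1_map Z1_map_linear.

Definition H1_map : H1 A -> H1 B :=
  lquot_lift (fun z => lpi (@image2 K B) (Z1_map z)).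

Lemma lpi_Z1_map z :
  z \in @image2 K A -> lpi (@image2 K B) (Z1_map z) = 0.
Proof.
move=> /asboolP[y yz]; apply/lpi_eq0/asboolP.
by exists (C2_map y); rewrite d2_map yz.
Qed.

Lemma H1_mapE z :
  H1_map (lpi (@image2 K A) z) = lpi (@image2 K B) (Z1_map z).
Proof.
exact: (@lquot_liftE K _ _ (H1 B) (lpi (@image2 K B) \o Z1_map) lpi_Z1_map).
Qed.

Lemma H1_map_linear : linear H1_map.
Proof.
exact: (@lquot_lift_linear K _ _ (H1 B) (lpi (@image2 K B) \o Z1_map)
          lpi_Z1_map).
Qed.

HB.instance Definition _ :=
  GRing.isLinear.Build K (H1 A) (H1 B) _ H1_map H1_map_linear.

End H1Map.

Record centralExt (K : fieldType) (Q : awbType K) := CentralExt {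
  ext_ker : awbType K;
  ext_mid : awbType K;
  ext_inj : {awbhom ext_ker -> ext_mid};
  ext_proj : {awbhom ext_mid -> Q};
  ext_injP : injective ext_inj;
  ext_exact : forall g, ext_proj g = 0 <-> exists n, ext_inj n = g;
  ext_surj : forall q, exists g, ext_proj g = q;
  ext_central : forall n, in_center (ext_inj n)
}.

Section CommutatorMaps.
Context (K : fieldType) (Q : awbType K) (E : centralExt Q).

Definition ext_section (q : Q) : ext_mid E := projT1 (cid (ext_surj E q)).

Lemma ext_sectionK q : ext_proj E (ext_section q) = q.
Proof. exact: projT2 (cid (ext_surj E q)). Qed.

Definition comm_br (q1 q2 : Q) : derived (ext_mid E) :=
  to_derived (derived_br (ext_section q1) (ext_section q2)).

Definition comm_mul (q1 q2 : Q) : derived (ext_mid E) :=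
  to_derived (derived_mul (ext_section q1) (ext_section q2)).

Lemma ext_section_proj g :
  exists n, ext_section (ext_proj E g) = ext_inj E n + g.
Proof.
have /ext_exact[n nE] : ext_proj E (ext_section (ext_proj E g) - g) = 0.
  by rewrite linearB /= ext_sectionK subrr.
by exists n; rewrite nE subrK.
Qed.

(* The commutator maps do not depend on the chosen preimages. *)
Lemma comm_brE g1 g2 : val (comm_br (ext_proj E g1) (ext_proj E g2)) = [br g1, g2].
Proof.
have [n1 e1] := ext_section_proj g1; have [n2 e2] := ext_section_proj g2.
rewrite /= e1 e2 -[ext_inj E n1]scale1r -[ext_inj E n2]scale1r awb_brPl !awb_brPr.
have [_ _ -> _] := ext_central n1 (ext_inj E n2).
have [_ _ -> _] := ext_central n1 g2.
by have [_ _ _ ->] := ext_central n2 g1; rewrite !(scaler0, add0r).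
Qed.

Lemma comm_mulE g1 g2 : val (comm_mul (ext_proj E g1) (ext_proj E g2)) = g1 ** g2.
Proof.
have [n1 e1] := ext_section_proj g1; have [n2 e2] := ext_section_proj g2.
rewrite /= e1 e2 -[ext_inj E n1]scale1r -[ext_inj E n2]scale1r awb_mulPl !awb_mulPr.
have [-> _ _ _] := ext_central n1 (ext_inj E n2).
have [-> _ _ _] := ext_central n1 g2.
by have [_ -> _ _] := ext_central n2 g1; rewrite !(scaler0, add0r).
Qed.

End CommutatorMaps.

Definition isoclinic (K : fieldType) (Q1 Q2 : awbType K)
    (E1 : centralExt Q1) (E2 : centralExt Q2) : Prop :=
  exists (eta : {awbhom Q1 -> Q2})
         (xi : {awbhom derived (ext_mid E1) -> derived (ext_mid E2)}),
    [/\ bijective eta, bijective xi,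
        forall q q', xi (comm_br E1 q q') = comm_br E2 (eta q) (eta q') &
        forall q q', xi (comm_mul E1 q q') = comm_mul E2 (eta q) (eta q')].

Definition stem_cover (K : fieldType) (Q : awbType K) (E : centralExt Q) : Prop :=
  bijective (ab_map (ext_proj E)) /\
  (forall h : H1 (ext_mid E), H1_map (ext_proj E) h = 0).

(* Main.v *)
Require Import Defs.
From mathcomp Require Import all_boot all_order all_algebra.
From HB Require Import structures.
From mathcomp Require Import boolp.

Set Implicit Arguments.
Unset Strict Implicit.
Unset Printing Implicit Defensive.

Import GRing.Theory.
Local Open Scope ring_scope.
Local Open Scope awb_scope.

(** A central extension [E] of [Q] with middle term [G] has bilinear commutator
    maps, so they assemble into a linear map [comm_lift E] from the chain space
    [C1 Q] to [[G, G]]; it is the factorization of [d1] of [G] through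
    [C1 G -> C1 Q].  It is onto, and its kernel contains the boundaries [d2 y],
    because these lift to boundaries of [G].  Conversely a chain in the kernel
    lifts to a cycle of [G], and its class in the first homology of [Q] comes
    from that of [G].  For a stem cover this class is zero, so that the kernel
    is exactly the image of [d2] ([comm_lift_eq0]).

    Hence [[G, G]], together with its commutator maps, is the quotient of [C1 Q]
    by the boundaries: it depends on [Q] only.  Two stem covers of [Q] are
    therefore isoclinic over the identity of [Q], through the map [transfer]
    that sends [comm_lift E1 x] to [comm_lift E2 x].  This map respects product
    and bracket, since those of [comm_lift E x] and [comm_lift E y] are the
    commutator maps of [E] at the elements [d1 x] and [d1 y] of [Q]. *)

Lemma linear_preim_sum (K : fieldType) (V W : lmodType K) (f : {linear V -> W})
    (I : eqType) (w : I -> W) (s : seq (K * I)) :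
  (forall p, p \in s -> exists v, f v = w p.2) ->
  exists v, f v = \sum_(p <- s) p.1 *: w p.2.
Proof.
elim: s => [_|p s IHs fs]; first by exists 0; rewrite linear0 big_nil.
have [|v fv] := IHs; first by move=> q qs; apply: fs; rewrite inE qs orbT.
have [u fu] := fs p (mem_head p s).
by exists (p.1 *: u + v); rewrite linearP big_cons fu fv.
Qed.

Lemma tensor_map_surj (K : fieldType) (U V U' V' : lmodType K)
    (f : {linear U -> U'}) (g : {linear V -> V'}) :
  (forall u, exists x, f x = u) -> (forall v, exists y, g y = v) ->
  forall t, exists s, tensor_map f g s = t.
Proof.
move=> f_surj g_surj t; have [s ->] := tensor_sum t.
apply: (linear_preim_sum (f := tensor_map f g) (w := fun p => tens p.1 p.2)).
move=> [c [u v]] _ /=; have [x <-] := f_surj u; have [y <-] := g_surj v.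
by exists (tens x y); rewrite tensor_mapE.
Qed.

Section ChainMapsSurjective.
Context (K : fieldType) (A B : awbType K) (f : {awbhom A -> B}).
Hypothesis f_surj : forall b, exists a, f a = b.

Lemma C1_map_surj x : exists x', C1_map f x' = x.
Proof.
case: x => x1 x2.
have [y1 e1] := tensor_map_surj f_surj f_surj x1.
have [y2 e2] := tensor_map_surj f_surj f_surj x2.
by exists (y1, y2); rewrite /C1_map e1 e2.
Qed.

Lemma C2_map_surj y : exists y', C2_map f y' = y.
Proof.
have f2_surj := tensor_map_surj f_surj f_surj.
case: y => y1 y2.
have [z1 e1] := tensor_map_surj f_surj f2_surj y1.
have [z2 e2] := tensor_map_surj f_surj f2_surj y2.
by exists (z1, z2); rewrite /C2_map e1 e2.
Qed.

End ChainMapsSurjective.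

Lemma d1_surj (K : fieldType) (A : awbType K) a :
  a \in @in_derived K A -> exists x, @d1 K A x = a.
Proof.
move=> /asboolP[s sP ->]; apply: (linear_preim_sum (w := id)) => p /sP.
by case=> b c; [exists (tens b c, 0) | exists (0, tens b c)];
  rewrite /= (d1_tens, d1_circ).
Qed.

Lemma derived_valP (K : fieldType) (A : awbType K) k (v w : derived A) :
  val (k *: v + w) = k *: val v + val w.
Proof. by []. Qed.

Section CommLift.
Context (K : fieldType) (Q : awbType K) (E : centralExt Q).
Local Notation G := (ext_mid E).
Local Notation proj := (ext_proj E).

Lemma comm_mul_bilinear : bilinear_for *:%R *:%R (comm_mul E).
Proof.
split=> [q k q1 q2|q k q1 q2] /=; apply: val_inj;
  have [g <-] := ext_surj E q; have [g1 <-] := ext_surj E q1;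
  have [g2 <-] := ext_surj E q2;
  rewrite -linearP derived_valP !comm_mulE.
- exact: awb_mulPl.
- exact: awb_mulPr.
Qed.

Lemma comm_br_bilinear : bilinear_for *:%R *:%R (comm_br E).
Proof.
split=> [q k q1 q2|q k q1 q2] /=; apply: val_inj;
  have [g <-] := ext_surj E q; have [g1 <-] := ext_surj E q1;
  have [g2 <-] := ext_surj E q2;
  rewrite -linearP derived_valP !comm_brE.
- exact: awb_brPl.
- exact: awb_brPr.
Qed.

Definition comm_lift (x : C1 Q) : derived G :=
  tensor_lift (comm_mul E) x.1 + tensor_lift (comm_br E) x.2.

Lemma comm_lift_linear : linear comm_lift.
Proof.
move=> k x y; rewrite /comm_lift /=.
rewrite (tensor_lift_linear comm_mul_bilinear).
rewrite (tensor_lift_linear comm_br_bilinear).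
by rewrite scalerDr addrACA.
Qed.

HB.instance Definition _ :=
  GRing.isLinear.Build K (C1 Q) (derived G) _ comm_lift comm_lift_linear.

Lemma comm_lift_tens q q' : comm_lift (tens q q', 0) = comm_mul E q q'.
Proof.
rewrite /comm_lift /= (tensor_liftE comm_mul_bilinear).
have := tensor_lift_linear comm_br_bilinear (-1) 0 0.
by rewrite scaler0 addr0 scaleN1r addNr => ->; rewrite addr0.
Qed.

Lemma comm_lift_circ q q' : comm_lift (0, tens q q') = comm_br E q q'.
Proof.
rewrite /comm_lift /= (tensor_liftE comm_br_bilinear).
have := tensor_lift_linear comm_mul_bilinear (-1) 0 0.
by rewrite scaler0 addr0 scaleN1r addNr => ->; rewrite add0r.
Qed.

(** The independence of the commutator maps from the chosen preimages, spread
    over chains: [d1] of the middle algebra factors through [C1 Q]. *)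
Lemma comm_lift_map x : val (comm_lift (C1_map proj x)) = d1 x.
Proof.
rewrite /comm_lift /d1 linearD /=; congr (_ + _).
- apply: (tensor_ext (f := fun t => val (tensor_lift (comm_mul E)
    (tensor_map proj proj t)))) (x.1) => [k s t||g g'].
  + by rewrite linearP (tensor_lift_linear comm_mul_bilinear) derived_valP.
  + exact: tensor_lift_linear (awb_mul_bilinear (s := G)).
  + rewrite tensor_mapE (tensor_liftE comm_mul_bilinear).
    by rewrite (tensor_liftE (awb_mul_bilinear (s := G))) comm_mulE.
- apply: (tensor_ext (f := fun t => val (tensor_lift (comm_br E)
    (tensor_map proj proj t)))) (x.2) => [k s t||g g'].
  + by rewrite linearP (tensor_lift_linear comm_br_bilinear) derived_valP.
  + exact: tensor_lift_linear (awb_br_bilinear (s := G)).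
  + rewrite tensor_mapE (tensor_liftE comm_br_bilinear).
    by rewrite (tensor_liftE (awb_br_bilinear (s := G))) comm_brE.
Qed.

Lemma proj_comm_lift x : proj (val (comm_lift x)) = d1 x.
Proof.
have [x' <-] := C1_map_surj (@ext_surj _ _ E) x.
by rewrite comm_lift_map d1_map.
Qed.

Lemma comm_lift_surj v : exists x, comm_lift x = v.
Proof.
have [x d1x] := d1_surj (valP v).
by exists (C1_map proj x); apply: val_inj; rewrite comm_lift_map.
Qed.

(** Products in the derived algebra only see the projections to [Q] of their
    factors, so [comm_lift] expresses them through [Q] alone. *)
Lemma comm_liftM x y :
  comm_lift x ** comm_lift y = comm_lift (tens (d1 x) (d1 y), 0).
Proof.
by apply: val_inj; rewrite comm_lift_tens -!proj_comm_lift comm_mulE.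
Qed.

Lemma comm_liftB x y :
  [br comm_lift x, comm_lift y] = comm_lift (0, tens (d1 x) (d1 y)).
Proof.
by apply: val_inj; rewrite comm_lift_circ -!proj_comm_lift comm_brE.
Qed.

Lemma comm_lift_d2 y : comm_lift (d2 y) = 0.
Proof.
have [y' <-] := C2_map_surj (@ext_surj _ _ E) y.
by apply: val_inj; rewrite d2_map comm_lift_map d1_d2.
Qed.

(** A chain of [Q] killed by [comm_lift] is the image of a cycle of the middle
    algebra, hence a boundary once the map on first homology is zero. *)
Lemma comm_lift_eq0 : (forall h : H1 G, H1_map proj h = 0) ->
  forall x, comm_lift x = 0 <-> exists y, d2 y = x.
Proof.
move=> H1_0 x; split=> [|[y <-]]; last exact: comm_lift_d2.
have [x' <-] := C1_map_surj (@ext_surj _ _ E) x => lift0.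
have x'Z : x' \in @kernel1 K G.
  by rewrite unfold_in -comm_lift_map lift0.
have := H1_0 (lpi (@image2 K G) (Subsp x'Z)).
by rewrite H1_mapE => /lpi_eq0/asboolP.
Qed.

End CommLift.

Section Transfer.
Context (K : fieldType) (Q : awbType K) (E1 E2 : centralExt Q).

(** The map [comm_lift E1 x |-> comm_lift E2 x]; meaningful if the kernel of
    [comm_lift E1] is contained in that of [comm_lift E2]. *)
Definition transfer (v : derived (ext_mid E1)) : derived (ext_mid E2) :=
  comm_lift E2 (projT1 (cid (comm_lift_surj v))).

Hypothesis ker_sub : forall x, comm_lift E1 x = 0 -> comm_lift E2 x = 0.

Lemma transferE x : transfer (comm_lift E1 x) = comm_lift E2 x.
Proof.
rewrite /transfer; case: cid => x' /= e.
have : comm_lift E2 (x' - x) = 0 by apply: ker_sub; rewrite linearB /= e subrr.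
by rewrite linearB => /subr0_eq.
Qed.

Lemma transfer_linear : linear transfer.
Proof.
move=> k v w; have [x <-] := comm_lift_surj v; have [y <-] := comm_lift_surj w.
by rewrite -linearP !transferE linearP.
Qed.

Lemma transferM v w : transfer (v ** w) = transfer v ** transfer w.
Proof.
have [x <-] := comm_lift_surj v; have [y <-] := comm_lift_surj w.
by rewrite comm_liftM !transferE comm_liftM.
Qed.

Lemma transferB v w : transfer [br v, w] = [br transfer v, transfer w].
Proof.
have [x <-] := comm_lift_surj v; have [y <-] := comm_lift_surj w.
by rewrite comm_liftB !transferE comm_liftB.
Qed.

Lemma transfer_awbhom :
  exists xi : {awbhom derived (ext_mid E1) -> derived (ext_mid E2)},
    xi =1 transfer.
Proof.
pose linM := GRing.isLinear.Build K (derived (ext_mid E1))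
  (derived (ext_mid E2)) _ transfer transfer_linear.
pose homM := isAWBHom.Build K (derived (ext_mid E1))
  (derived (ext_mid E2)) transfer transferM transferB.
pose xi : {awbhom derived (ext_mid E1) -> derived (ext_mid E2)} :=
  HB.pack transfer linM homM.
by exists xi.
Qed.

End Transfer.

Lemma transferK (K : fieldType) (Q : awbType K) (E1 E2 : centralExt Q) :
  (forall x, comm_lift E1 x = 0 <-> comm_lift E2 x = 0) ->
  cancel (@transfer K Q E1 E2) (@transfer K Q E2 E1).
Proof.
move=> ker_eq v; have [x <-] := comm_lift_surj v.
by rewrite !transferE // => y /ker_eq.
Qed.

HB.instance Definition _ (K : fieldType) (A : awbType K) :=
  isAWBHom.Build K A A idfun (fun _ _ => erefl) (fun _ _ => erefl).

Theorem proposition5p12 (K : fieldType) (Q : awbType K) (E1 E2 : centralExt Q)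
    (hE1 : stem_cover E1) (hE2 : stem_cover E2) : isoclinic E1 E2.
Proof.
have ker_eq x : comm_lift E1 x = 0 <-> comm_lift E2 x = 0.
  by rewrite (comm_lift_eq0 hE1.2) (comm_lift_eq0 hE2.2).
have ker_sub x : comm_lift E1 x = 0 -> comm_lift E2 x = 0 by case: (ker_eq x).
have [xi xiE] := transfer_awbhom ker_sub.
exists idfun, xi; split.
- by exists idfun.
- apply: (eq_bij _ (fsym xiE)).
  by exists (@transfer K Q E2 E1); apply: transferK => // x; apply: iff_sym.
- by move=> q q'; rewrite xiE -!comm_lift_circ (transferE ker_sub).
- by move=> q q'; rewrite xiE -!comm_lift_tens (transferE ker_sub).
Qed.
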